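(* There exist probability measures $\mu,\nu$ on $\{0,1\}^{\mathbb{N}}$ such that $\mathbb{E}_{X\sim\mu}[X_iX_j]=\mathbb{E}_{X\sim\nu}[X_iX_j]$ for all $i,j\in\mathbb{N}$, while $\Delta_n(\mu)\to0$ and $\Delta_n(\nu)\to\tfrac12$ as $n\to\infty$.
   Context: For a probability measure $\mu$ on $\{0,1\}^{\mathbb{N}}$ and $n\ge1$, with $X^{(1)},\dots,X^{(n)}$ i.i.d. from $\mu$, $\Delta_n(\mu):=\mathbb{E}\sup_{j\in\mathbb{N}}\left|\frac1n\sum_{i=1}^nX^{(i)}_j-\mathbb{E}[X_j]\right|$. *)

(* Defs.v *)
From HB Require Import structures.
From mathcomp Require Import all_boot all_order all_algebra.
From mathcomp Require Import all_classical all_reals all_analysis.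
Set Implicit Arguments. Unset Strict Implicit. Unset Printing Implicit Defensive.
Import Order.TTheory GRing.Theory Num.Theory.
Local Open Scope classical_set_scope.
Local Open Scope ring_scope.

Definition cyl_gen : set (set (nat -> bool)) :=
  [set [set x : nat -> bool | x j] | j in [set: nat]].

Definition Cantor : Type := g_sigma_algebraType cyl_gen.
HB.instance Definition _ := Pointed.on Cantor.
HB.instance Definition _ := Measurable.on Cantor.

Definition bitX {R : realType} (j : nat) (x : Cantor) : R := (x j)%:R.

Section Delta.
Context {R : realType} (mu : probability Cantor R).
Local Open Scope ereal_scope.

Definition mean (j : nat) : R := fine (\int[mu]_x (bitX j x)%:E).

(* Expectation over n i.i.d. samples from mu (the list of samples is passed
   to f), written as the iterated integral w.r.t. mu^{(x)n} (Tonelli). *)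
Fixpoint iid_expect (n : nat) (f : seq Cantor -> \bar R) : \bar R :=
  match n with
  | 0%N => f [::]
  | k.+1 => \int[mu]_x iid_expect k (fun s => f (x :: s))
  end.

Definition dev (s : seq Cantor) : \bar R :=
  ereal_sup [set (`| (size s)%:R^-1 * (\sum_(x <- s) bitX j x) - mean j |)%:E
            | j in [set: nat]].

Definition Delta (n : nat) : \bar R := iid_expect n dev.

End Delta.

(* Main.v *)
Require Import Defs.
From HB Require Import structures.
From mathcomp Require Import all_boot all_order all_algebra.
From mathcomp Require Import all_classical all_reals all_analysis.
From mathcomp Require Import measurable_realfun zify ring lra.
Set Implicit Arguments. Unset Strict Implicit. Unset Printing Implicit Defensive.
Import Order.TTheory GRing.Theory Num.Theory.
Local Open Scope classical_set_scope.
Local Open Scope ring_scope.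

(** The coordinates are grouped into blocks: block m has one coordinate for each
    pattern phi, which assigns one of N cells to each of m + 1 columns, with
    N + 1 = 4 * 2^m.  Every coordinate is a common fair coin c, flipped when the
    noise of its block says so; the noises are independent of c and of each other.

    Under nu the noise is a uniform column i and a uniform t among None and the
    cells, and phi flips when t = None or t = Some (phi i).  Under mu it is a
    uniform column i, an independent event of probability 2^-m and fair bits
    eps(v), v a cell, and phi flips when the event occurs and eps(phi i) = 1.
    Conditionally on i, the sign of a flip has mean 1 - 4/(N + 1) under both laws,
    and the product of the signs of phi and psi has this same mean if
    phi i <> psi i and is 1 otherwise.  So mu and nu have the same second moments.

    Under mu, outside an event of small probability, all coordinates of large
    index agree (Borel-Cantelli), so the supremum is essentially over finitely
    many coordinates and the variance bound suffices.  Under nu, n samples fall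
    into distinct columns with t <> None with probability close to 1 in a late
    block, and then phi can be chosen on these columns so that all n samples have
    bit 1 at phi; hence Delta_n(nu) = 1/2. *)

(** * Averages over the naturals below [q] *)

Definition avg (R : realType) (q : nat) (g : nat -> R) : R :=
  q%:R^-1 * \sum_(a < q) g a.

Lemma eq_avg (R : realType) q (f g : nat -> R) :
  (forall a, (a < q)%N -> f a = g a) -> avg q f = avg q g.
Proof. by move=> fg; congr (_ * _); apply: eq_bigr => a _; exact: fg. Qed.

Lemma avg_cst (R : realType) q (c : R) : (0 < q)%N -> avg q (fun=> c) = c.
Proof.
move=> q0; rewrite /avg sumr_const card_ord -[c *+ q]mulr_natl mulrA mulVf ?mul1r//.
by rewrite pnatr_eq0 -lt0n.
Qed.

(** Quotient and remainder by [q] are independent for a uniform [a] below [Q * q]. *)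
Lemma avg_divmod (R : realType) Q q (F G : nat -> R) :
  avg (Q * q) (fun a => F (a %/ q)%N * G (a %% q)%N) = avg Q F * avg q G.
Proof.
rewrite /avg natrM invfM mulrACA; congr (_ * _).
have [->|q0] := posnP q.
  by rewrite muln0 !big_ord0 mulr0.
rewrite big_distrlr /=.
rewrite -(big_mkord predT (fun a => F (a %/ q)%N * G (a %% q)%N)) big_nat_mul /=.
rewrite big_mkord; apply: eq_bigr => i _.
rewrite mulSn -{1}[(i * q)%N]add0n big_addn addnK big_mkord.
apply: eq_bigr => j _; rewrite !(addnC (val j)) divnMDl// modnMDl.
by rewrite divn_small ?modn_small ?addn0 ?ltn_ord.
Qed.

(** * Independent uniform digits on [0, 1[ *)

Section uniform01.
Variable R : realType.

Definition unif01 :=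
  mrestr (@lebesgue_measure R) (measurable_itv `[0%R, 1%R[).

HB.instance Definition _ := Measure.on unif01.

Let unif01_setT : unif01 [set: R] = 1%E.
Proof.
rewrite /unif01 /mrestr setTI.
by rewrite lebesgue_measure_itv/= lte_fin ltr01 oppr0 adde0.
Qed.

HB.instance Definition _ := @Measure_isProbability.Build _ _ R unif01 unif01_setT.

(* The [if] makes the junk values outside [0, 1[ lie in {0, ..., Q - 1}. *)
Definition cell (Q : nat) (w : R) : nat :=
  if 0 <= w < 1 then Num.truncn (Q%:R * w) else 0%N.

Lemma cell_eq Q a w : (0 < Q)%N -> 0 <= w < 1 ->
  (cell Q w == a) = (a%:R / Q%:R <= w < a.+1%:R / Q%:R).
Proof.
move=> Q0 w01; rewrite /cell w01 truncn_eq; last first.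
  by rewrite mulr_ge0//; case/andP: w01.
by rewrite ler_pdivrMr ?ltr_pdivlMr ?ltr0n// (mulrC w).
Qed.

Lemma cell_lt Q w : (0 < Q)%N -> (cell Q w < Q)%N.
Proof.
move=> Q0; rewrite /cell; case: ifPn => // /andP[w0 w1].
by rewrite truncn_lt_nat ?mulr_ge0// gtr_pMr// ltr0n.
Qed.

(** Each cell of width 1/(Q q) lies inside a single cell of width 1/Q. *)
Lemma cell_div Q q w : (0 < Q)%N -> (0 < q)%N ->
  (cell (Q * q) w %/ q)%N = cell Q w.
Proof.
move=> Q0 q0; case: (boolP (0 <= w < 1)) => w01; last first.
  by rewrite /cell (negbTE w01) div0n.
have Qq0 : (0 < Q * q)%N by rewrite muln_gt0 Q0.
apply/esym/eqP; rewrite cell_eq//.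
have := eqxx (cell (Q * q) w); rewrite cell_eq// => /andP[+ +].
have Qr : 0 < Q%:R :> R by rewrite ltr0n.
have qr : 0 < q%:R :> R by rewrite ltr0n.
set a := cell _ _; rewrite !ler_pdivrMr ?ltr_pdivlMr ?ltr0n// natrM => h1 h2.
have e1 : ((a %/ q)%:R * q%:R <= a%:R :> R).
  by rewrite -natrM ler_nat leq_trunc_div.
have e2 : (a.+1%:R <= (a %/ q).+1%:R * q%:R :> R).
  by rewrite -natrM ler_nat ltn_ceil.
apply/andP; split.
  by rewrite -(ler_pM2r qr) -mulrA; exact: le_trans h1.
by rewrite -(ltr_pM2r qr) -mulrA; exact: lt_le_trans e2.
Qed.

Lemma measurable_cell Q (A : set nat) : (0 < Q)%N ->
  measurable (cell Q @^-1` A).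
Proof.
move=> Q0; have -> : cell Q @^-1` A = \bigcup_(a in A) (cell Q @^-1` [set a]).
  apply/seteqP; split => [w Aw|w [a Aa /= wa]] /=; last by rewrite wa.
  by exists (cell Q w).
apply: bigcup_measurable => a _.
(* The default value of [cell] puts everything outside [0, 1[ into the preimage of 0. *)
have -> : cell Q @^-1` [set a] =
    (`[0, 1[ `&` `[a%:R / Q%:R, a.+1%:R / Q%:R[) `|`
    (~` `[0, 1[ `&` [set _ | a = 0%N]).
  apply/seteqP; split => w /=; rewrite !in_itv/=.
    case: (boolP (0 <= w < 1)) => w01; last by rewrite /cell (negbTE w01); right.
    by move=> /eqP; rewrite cell_eq//; left.
  case=> [[w01 h]|[/negP/negbTE w01 ->]]; last by rewrite /cell w01.
  by apply/eqP; rewrite cell_eq.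
apply: measurableU; first exact: measurableI.
apply: measurableI; first exact: measurableC.
have [->|a0] := eqVneq a 0%N.
  by rewrite (_ : [set _ | _] = setT)//; apply/seteqP.
rewrite (_ : [set _ | _] = set0)//.
by apply/seteqP; split => // x /= /eqP; rewrite (negbTE a0).
Qed.

Lemma unif01_cell Q a : (a < Q)%N -> unif01 (cell Q @^-1` [set a]) = (Q%:R^-1)%:E.
Proof.
move=> aQ; have Q0 : (0 < Q)%N by exact: leq_ltn_trans aQ.
have Qr : 0 < Q%:R :> R by rewrite ltr0n.
rewrite /unif01 /mrestr.
rewrite (_ : _ `&` _ = `[a%:R / Q%:R, a.+1%:R / Q%:R[%classic); last first.
  apply/seteqP; split => w /=; rewrite !in_itv/=.
    by move=> [/eqP + w01]; rewrite cell_eq.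
  move=> h; have w01 : 0 <= w < 1.
    case/andP: h => h1 h2; rewrite (le_trans _ h1)/= ?divr_ge0//.
    by rewrite (lt_le_trans h2)// ler_pdivrMr// mul1r ler_nat.
  by split=> //; apply/eqP; rewrite cell_eq.
rewrite lebesgue_measure_itv/= lte_fin ltr_pM2r ?invr_gt0// ltr_nat ltnSn.
by rewrite -EFinB -mulrBl -natrB// subSnn mul1r.
Qed.

Lemma integral_cell Q (F : nat -> R) : (0 < Q)%N ->
  (\int[unif01]_w (F (cell Q w))%:E = (avg Q F)%:E)%E.
Proof.
move=> Q0; transitivity (\int[unif01]_w
    (\sum_(a < Q) (F a)%:E * (\1_(cell Q @^-1` [set val a]) w)%:E))%E.
  apply: eq_integral => w _.
  rewrite (bigD1 (Ordinal (cell_lt w Q0)))//= indicE mem_set//= mule1.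
  rewrite big1 ?adde0// => a /eqP aw; rewrite indicE memNset ?mule0//= => aw'.
  by apply: aw; apply: val_inj.
rewrite integral_sum//; last first.
  move=> a; apply: integrableZl => //; apply: integrable_indic.
  exact: measurable_cell.
rewrite /avg mulr_sumr -sumEFin; apply: eq_bigr => a _.
rewrite integralZl//; last by apply: integrable_indic; exact: measurable_cell.
rewrite integral_indic//; last exact: measurable_cell.
by rewrite setIT [X in (_ * X)%E](unif01_cell (ltn_ord a)) -EFinM mulrC.
Qed.

End uniform01.

(** * Mixed-radix digits *)

Section digits.
Variables (R : realType) (q : nat -> nat).
Hypothesis q_gt0 : forall k, (0 < q k)%N.

Definition radix K : nat := (\prod_(k < K) q k)%N.

(** Digits of the expansion with radices [q 0], [q 1], ..., the most significant first. *)
Definition digit k (w : R) : nat := (cell (radix k.+1) w %% q k)%N.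

Let radix_gt0 K : (0 < radix K)%N.
Proof. by rewrite /radix prodn_gt0. Qed.

Let radixS K : radix K.+1 = (radix K * q K)%N.
Proof. by rewrite /radix big_ord_recr. Qed.

Lemma measurable_digit k (A : set nat) : measurable (digit k @^-1` A).
Proof. exact: (@measurable_cell R _ [set a | A (a %% q k)%N]). Qed.

(** The product is a function of the one cell index at resolution [radix K]; each further digit
    splits off as a remainder, and [avg_divmod] factors the average. *)
Lemma integral_digits (G : nat -> nat -> R) K :
  (\int[@unif01 R]_w (\prod_(k < K) G k (digit k w))%:E
   = (\prod_(k < K) avg (q k) (G k))%:E)%E.
Proof.
have [F [FE Favg]] : exists F : nat -> R,
    (forall w, \prod_(k < K) G k (digit k w) = F (cell (radix K) w)) /\
    avg (radix K) F = \prod_(k < K) avg (q k) (G k).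
  elim: K => [|K [F [FE Favg]]].
    exists (fun=> 1); split => [w|]; rewrite big_ord0//.
    by rewrite avg_cst// /radix big_ord0.
  exists (fun a => F (a %/ q K)%N * G K (a %% q K)%N); split => [w|].
    by rewrite big_ord_recr /= FE radixS cell_div// /digit radixS.
  by rewrite radixS avg_divmod Favg big_ord_recr.
by under eq_integral do rewrite FE; rewrite integral_cell// Favg.
Qed.

Lemma integral_digit1 k (f : nat -> R) :
  (\int[@unif01 R]_w (f (digit k w))%:E = (avg (q k) f)%:E)%E.
Proof.
have := integral_digits (fun i a => if i == k then f a else 1) k.+1.
rewrite [in RHS](bigD1 ord_max)//= eqxx [in RHS]big1 ?mulr1; last first.
  move=> i; rewrite -val_eqE/= => ik; rewrite -[RHS](avg_cst 1 (q_gt0 i)).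
  by rewrite (eq_avg (g := fun=> 1))// => a _; rewrite ifN.
move=> <-; apply: eq_integral => w _; congr EFin.
rewrite (bigD1 ord_max)//= eqxx big1 ?mulr1// => i.
by rewrite -val_eqE/= => ik; rewrite ifN.
Qed.

Lemma integral_digit2 k l (f g : nat -> R) : k != l ->
  (\int[@unif01 R]_w (f (digit k w) * g (digit l w))%:E
   = (avg (q k) f * avg (q l) g)%:E)%E.
Proof.
move=> kl; pose K := (maxn k l).+1.
have kK : (k < K)%N by rewrite ltnS leq_maxl.
have lK : (l < K)%N by rewrite ltnS leq_maxr.
have lk' : Ordinal lK != Ordinal kK by rewrite -val_eqE/= eq_sym.
have := integral_digits
  (fun i a => if i == k then f a else if i == l then g a else 1) K.
rewrite [in RHS](bigD1 (Ordinal kK))//= eqxx.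
rewrite [in RHS](bigD1 (Ordinal lK))//= (eq_sym l) (negbTE kl) eqxx.
rewrite [in RHS]big1 ?mulr1; last first.
  move=> i; rewrite -!val_eqE/= => /andP[ik il]; rewrite -[RHS](avg_cst 1 (q_gt0 i)).
  by apply: eq_avg => a _; rewrite !ifN.
move=> <-; apply: eq_integral => w _; congr EFin.
rewrite (bigD1 (Ordinal kK))//= eqxx.
rewrite (bigD1 (Ordinal lK))//= (eq_sym l) (negbTE kl) eqxx.
by rewrite big1 ?mulr1// => i; rewrite -!val_eqE/= => /andP[ik il]; rewrite !ifN.
Qed.

Lemma unif01_digit k (A : pred nat) :
  unif01 [set w | A (digit k w)] = (avg (q k) (fun a => (A a)%:R))%:E.
Proof.
rewrite -integral_digit1.
transitivity (\int[@unif01 R]_w (\1_[set w | A (digit k w)] w)%:E)%E.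
  by rewrite integral_indic ?setIT//; exact: (measurable_digit k A).
apply: eq_integral => w _; congr EFin; rewrite indicE.
by case: (boolP (A _)) => h; [rewrite mem_set|rewrite memNset//; exact/negP].
Qed.

End digits.

(** * Integrals of bounded functions *)

Section integral_probability.
Context d (T : measurableType d) (R : realType) (P : probability T R).

Lemma bounded_integrable (f : T -> R) (M : R) :
  measurable_fun [set: T] f -> (forall x, `|f x| <= M) ->
  P.-integrable [set: T] (EFin \o f).
Proof.
move=> mf fM; apply: measurable_bounded_integrable => //.
  by rewrite [ltLHS](probability_setT P) ltry.
exists M; split; first exact: num_real.
by move=> N MN x _; exact: le_trans (fM x) (ltW MN).
Qed.

Lemma integral_affine (I : Type) (s : seq I) (a : R) (c e : I -> R)
    (f : I -> T -> R) :
  (forall i, P.-integrable [set: T] (EFin \o f i)) ->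
  (forall i, (\int[P]_x (f i x)%:E = (e i)%:E)%E) ->
  (\int[P]_x (a + \sum_(i <- s) c i * f i x)%:E
   = (a + \sum_(i <- s) c i * e i)%:E)%E.
Proof.
move=> fi fe; have cfi i : P.-integrable [set: T] (fun x => (c i)%:E * (f i x)%:E)%E.
  by apply: (@integrableZl _ _ _ _ _ _ _ (EFin \o f i)).
under eq_integral.
  move=> x _; rewrite EFinD -sumEFin.
  under eq_bigr do rewrite EFinM.
  over.
rewrite integralD//; last 2 first.
- by apply: (bounded_integrable (M := `|a|)).
- exact: (integrable_sum _ _ (fun i _ => cfi i)).
rewrite integral_cst// [X in (_ * X)%E](probability_setT P) mule1 EFinD integral_sum//.
rewrite -sumEFin; congr (_ + _)%E; apply: eq_bigr => i _.
by rewrite (integralZl _ (fi i))// fe EFinM.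
Qed.

(** The integral of a nonnegative function is the supremum over the simple functions below it, and a
    larger function admits more of them. This applies to the iterated integrals of [Delta], whose
    measurability is never established. *)
Lemma ge0_le_integral_nomeas (f g : T -> \bar R) : (forall x, 0 <= f x)%E ->
  (forall x, f x <= g x)%E -> (\int[P]_x f x <= \int[P]_x g x)%E.
Proof.
move=> f0 fg; have g0 x : (0 <= g x)%E by exact: le_trans (fg x).
rewrite !ge0_integralTE//; apply: le_ereal_sup => _ [h hf <-].
by exists h => // x; exact: le_trans (fg x).
Qed.

End integral_probability.

(** * Laws of block type *)

Definition sgb (R : pzRingType) (b : bool) : R := (-1) ^+ b.

Lemma measurable_bit j : measurable [set x : Cantor | x j].
Proof. by apply: sub_sigma_algebra; exists j. Qed.

Lemma bitX_indic (R : realType) j : @bitX R j = \1_[set x : Cantor | x j].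
Proof.
apply/funext => x; rewrite indicE /bitX; case: (boolP (x j)) => xj.
  by rewrite mem_set.
by rewrite memNset//; exact/negP.
Qed.

Lemma measurable_bitX (R : realType) j : measurable_fun [set: Cantor] (@bitX R j).
Proof. by rewrite bitX_indic; apply/measurable_indicP; exact: measurable_bit. Qed.

Section block_model.
Variables (R : realType) (q : nat -> nat) (beta : nat -> nat).
Variable y : nat -> nat -> bool.

(* Digit 0 is the fair coin shared by all the bits, digit m.+1 is the noise of block m. *)
Definition block_radices (k : nat) : nat := if k is m.+1 then (q m).+1 else 2.

Let q_gt0 k : (0 < block_radices k)%N.
Proof. by case: k. Qed.

Local Notation dig := (@digit R block_radices).

Definition bits (w : measurableTypeR R) : Cantor :=
  fun j => odd (dig 0 w) (+) y j (dig (beta j).+1 w).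

Lemma measurable_bits : measurable_fun [set: measurableTypeR R] bits.
Proof.
apply: (@measurability _ _ _ _ _ bits (cyl_gen : set (set Cantor))) => // _ [_ [j _ <-] <-].
rewrite setTI.
pose A := dig 0 @^-1` [set a | odd a].
pose B := dig (beta j).+1 @^-1` [set a | y j a].
have mA : measurable A by exact: measurable_digit.
have mB : measurable B by exact: measurable_digit.
have -> : bits @^-1` [set x | x j] = (A `\` B) `|` (B `\` A).
  apply/seteqP; split => w; rewrite /bits /A /B /=.
    by case: (odd _); case: (y _ _) => //=; [left|right].
  by case: (odd _); case: (y _ _) => //= -[[]//|[]//].
by apply: measurableU; exact: measurableD.
Qed.

HB.instance Definition _ :=
  isMeasurableFun.Build _ _ _ _ bits measurable_bits.

Definition law : probability Cantor R := distribution (@unif01 R) bits.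

Lemma measurable_fun_digit (k : nat) (f : nat -> R) :
  measurable_fun [set: measurableTypeR R] (f \o dig k).
Proof. by move=> _ A _; rewrite setTI; exact: (measurable_digit q_gt0 _ (f @^-1` A)). Qed.

Lemma integral_law (f : Cantor -> \bar R) : measurable_fun [set: Cantor] f ->
  (forall x, 0 <= f x)%E -> (\int[law]_x f x = \int[@unif01 R]_w f (bits w))%E.
Proof. by move=> mf f0; rewrite ge0_integral_distribution. Qed.

(** The mean product of two noise signs: bits of one block read the same digit, bits of different
    blocks independent ones. *)
Definition block_corr (i j : nat) : R :=
  if beta i == beta j
  then avg (q (beta i)).+1 (fun a => sgb R (y i a) * sgb R (y j a))
  else avg (q (beta i)).+1 (fun a => sgb R (y i a))
       * avg (q (beta j)).+1 (fun a => sgb R (y j a)).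

Let sgb_norm b : `|sgb R b| = 1.
Proof. by rewrite /sgb normrX normrN1 expr1n. Qed.

(** With coin sign s and noise sign t, a bit is (1 - s t) / 2. In the product of two bits s^2 = 1,
    and the terms linear in s vanish because s is centred and independent of the noise. *)
Lemma second_moment i j :
  (\int[law]_x (bitX i x * bitX j x)%:E = ((1 + block_corr i j) / 4)%:E)%E.
Proof.
rewrite integral_law; last 2 first.
- apply/measurable_EFinP; apply: measurable_funM; exact: measurable_bitX.
- by move=> x; rewrite lee_fin mulr_ge0.
pose s (w : R) : R := sgb R (odd (dig 0 w)).
pose t j (w : R) : R := sgb R (y j (dig (beta j).+1 w)).
have bE j' w : bitX j' (bits w) = (1 - s w * t j' w) / 2.
  rewrite /bitX /bits /s /t /sgb; case: (odd _); case: (y _ _) => /=; lra.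
pose f (k : 'I_3) (w : R) : R :=
  if k == 0 then s w * t i w else if k == 1 then s w * t j w else t i w * t j w.
pose c (k : 'I_3) : R := if k == 2 then 4^-1 else - 4^-1.
have mt j' : measurable_fun [set: measurableTypeR R] (t j').
  exact (@measurable_fun_digit (beta j').+1 (fun a => sgb R (y j' a))).
have ms : measurable_fun [set: measurableTypeR R] s.
  exact (@measurable_fun_digit 0 (fun a => sgb R (odd a))).
have st j' : (\int[@unif01 R]_w (s w * t j' w)%:E = 0)%E.
  rewrite /s /t (integral_digit2 q_gt0 (fun a => sgb R (odd a))
    (fun a => sgb R (y j' a)))//.
  by rewrite [X in X * _]/avg !big_ord_recr big_ord0 /= /sgb expr0 expr1 add0r subrr mulr0 mul0r.
have tt : (\int[@unif01 R]_w (t i w * t j w)%:E = (block_corr i j)%:E)%E.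
  rewrite /block_corr /t; case: ifPn => [/eqP <-|bij].
    exact: (integral_digit1 q_gt0 _ (fun a => sgb R (y i a) * sgb R (y j a))).
  by rewrite (integral_digit2 q_gt0 (fun a => sgb R (y i a)) (fun a => sgb R (y j a))).
transitivity (\int[@unif01 R]_w (4^-1 + \sum_k c k * f k w)%:E)%E.
  apply: eq_integral => w _; congr EFin.
  rewrite !bE !big_ord_recr big_ord0 /c /f /=.
  by rewrite /s /sgb; case: (odd _); rewrite ?expr0 ?expr1; field.
rewrite (@integral_affine _ _ R (@unif01 R) _ _ _ c (fun k => if k == 2 then block_corr i j else 0) f).
- by rewrite !big_ord_recr big_ord0 /c /=; congr EFin; field.
- move=> k; apply: (@bounded_integrable _ _ R (@unif01 R) (f k) 1).
    by rewrite /f; case: (k == 0); [|case: (k == 1)]; exact: measurable_funM.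
  by move=> w; rewrite /f; case: (k == 0); [|case: (k == 1)]; rewrite normrM !sgb_norm mulr1.
- by case=> -[|[|[|m]]] //= k3; rewrite /f /=; first [exact: st|exact: tt].
Qed.

Lemma law_fair j : (\int[law]_x (bitX j x)%:E = (2^-1)%:E)%E.
Proof.
transitivity (\int[law]_x (bitX j x * bitX j x)%:E)%E.
  by apply: eq_integral => x _; rewrite /bitX; case: (x j); rewrite ?mulr1 ?mulr0.
rewrite second_moment /block_corr eqxx.
rewrite (eq_avg (g := fun=> 1)); last first.
  by move=> a _; rewrite /sgb -expr2 sqrr_sign.
by rewrite avg_cst//; congr EFin; field.
Qed.

End block_model.

(** * Bounds on Delta *)

Section iid_expectation.
Variables (R : realType) (mu : probability Cantor R).
Local Open Scope ereal_scope.

Lemma iid_expect_ge0 n (f : seq Cantor -> \bar R) :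
  (forall s, 0 <= f s) -> 0 <= iid_expect mu n f.
Proof.
elim: n f => [|n IH] f f0 //=.
by apply: integral_ge0 => x _; exact: IH.
Qed.

Lemma le_iid_expect n (f g : seq Cantor -> \bar R) : (forall s, 0 <= f s) ->
  (forall s, size s = n -> f s <= g s) -> iid_expect mu n f <= iid_expect mu n g.
Proof.
elim: n f g => [|n IH] f g f0 fg /=; first exact: fg.
apply: ge0_le_integral_nomeas => x; first exact: iid_expect_ge0.
by apply: IH => // s sn; apply: fg; rewrite /= sn.
Qed.

Lemma iid_expect_cst n (r : R) : iid_expect mu n (fun=> r%:E) = r%:E.
Proof.
elim: n => [|n IH] //=; under eq_integral do rewrite IH.
by rewrite integral_cst// [X in _ * X](probability_setT mu) mule1.
Qed.

End iid_expectation.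

Lemma measurable_pattern (F : finType) (idx : F -> nat) (A : pred {ffun F -> bool}) :
  measurable [set x : Cantor | A [ffun phi => x (idx phi)]].
Proof.
have -> : [set x : Cantor | A [ffun phi => x (idx phi)]] =
    \bigcup_(p in [set p | A p])
      \bigcap_(phi in [set: F]) [set x : Cantor | x (idx phi) = p phi].
  apply/seteqP; split => x /=.
    move=> Ax; exists [ffun phi => x (idx phi)] => //= phi _ /=.
    by rewrite ffunE.
  move=> [p /= Ap xp]; rewrite (_ : [ffun _ => _] = p)//.
  by apply/ffunP => phi; rewrite ffunE; exact: xp.
apply: fin_bigcup_measurable => [|p _]; first exact: finite_finset.
apply: fin_bigcap_measurable => [|phi _]; first exact: finite_finset.
case: (p phi); first exact: measurable_bit.
rewrite (_ : [set x : Cantor | _] = ~` [set x | x (idx phi)]).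
  by apply: measurableC; exact: measurable_bit.
by apply/seteqP; split => x /=; case: (x _).
Qed.

Lemma measurable_survivors (F : finType) (idx : F -> nat) (A : pred {set F}) (W : {set F}) :
  measurable [set x : Cantor | A [set phi in W | x (idx phi)]%SET].
Proof.
pose A' (p : {ffun F -> bool}) := A [set phi in W | p phi]%SET.
rewrite (_ : [set _ | _] = [set x : Cantor | A' [ffun phi => x (idx phi)]]).
  exact: measurable_pattern.
apply/funext => x; rewrite /A' /=; congr (is_true (A _)).
by apply/setP => phi; rewrite !inE ffunE.
Qed.

Section fair_law.
Variables (R : realType) (mu : probability Cantor R).
Hypothesis mu_fair : forall j, (\int[mu]_x (bitX j x)%:E = (2^-1)%:E)%E.

Lemma fair_mean j : mean mu j = 2^-1.
Proof. by rewrite /mean mu_fair. Qed.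

Lemma dev_ge0 s : (0 <= dev mu s)%E.
Proof.
apply: (@le_trans _ _ (`|(size s)%:R^-1 * (\sum_(x <- s) bitX 0 x) - mean mu 0|)%:E).
  by rewrite lee_fin.
by apply: ereal_sup_ubound; exists 0%N.
Qed.

Lemma dev_le_half s : (dev mu s <= (2^-1)%:E)%E.
Proof.
apply: ge_ereal_sup => _ [j _ <-]; rewrite lee_fin fair_mean.
have S0 : 0 <= \sum_(x <- s) bitX j x :> R by apply: sumr_ge0 => x _; rewrite /bitX.
have S1 : \sum_(x <- s) bitX j x <= (size s)%:R :> R.
  rewrite -sum1_size natr_sum; apply: ler_sum => x _.
  by rewrite /bitX lern1 leq_b1.
(* For the empty sample the inverse of 0 is 0, and the deviation is exactly 1/2. *)
have [s0|s0] := posnP (size s).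
  by rewrite s0 invr0 mul0r sub0r normrN ger0_norm// invr_ge0.
have sr : 0 < (size s)%:R :> R by rewrite ltr0n.
have h0 : 0 <= (size s)%:R^-1 * \sum_(x <- s) bitX j x :> R.
  by rewrite mulr_ge0// invr_ge0.
have h1 : (size s)%:R^-1 * \sum_(x <- s) bitX j x <= 1 :> R.
  by rewrite mulrC ler_pdivrMr// mul1r.
rewrite ler_norml; apply/andP; split; lra.
Qed.

Lemma Delta_le_half n : (Delta mu n <= (2^-1)%:E)%E.
Proof.
rewrite -(iid_expect_cst mu n 2^-1); apply: le_iid_expect => s; first exact: dev_ge0.
by move=> _; exact: dev_le_half.
Qed.

Lemma dev_half_of_unanimous s j : all (fun x : Cantor => x j) s ->
  ((2^-1)%:E <= dev mu s)%E.
Proof.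
move=> sj.
apply: (@le_trans _ _ (`|(size s)%:R^-1 * (\sum_(x <- s) bitX j x) - mean mu j|)%:E); last first.
  by apply: ereal_sup_ubound; exists j.
rewrite lee_fin fair_mean.
have [->|s0] := eqVneq s [::].
  by rewrite big_nil mulr0 sub0r normrN ger0_norm// invr_ge0.
have -> : \sum_(x <- s) bitX j x = (size s)%:R :> R.
  rewrite -sum1_size natr_sum big_seq [RHS]big_seq; apply: eq_bigr => x xs.
  by rewrite /bitX (allP sj x xs).
rewrite mulVf ?pnatr_eq0 ?size_eq0//.
by rewrite ger0_norm; lra.
Qed.

(** * Lower bound from indices at which all samples have bit 1 *)

Section survivors.
Variables (F : finType) (idx : F -> nat) (good : nat -> {set F} -> bool).
Variable eta : nat -> R.
Hypothesis eta_ge0 : forall k, 0 <= eta k.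
Hypothesis good_neq0 : forall k W, good k W -> W != finset.set0.
Hypothesis good_next : forall k W, good k W ->
  ((1 - eta k)%:E <=
     mu [set x | good k.+1 [set phi in W | x (idx phi)]%SET])%E.

(** [W] holds the indices that are still unanimous after [k] samples, and [good] is an invariant.
    Each new sample breaks it with probability at most [eta k], and these losses add up. *)
Lemma iid_expect_unanimous n k W : good k W ->
  ((2^-1 * (1 - \sum_(l < n) eta (k + l)%N))%:E <=
   iid_expect mu n (fun s => (2^-1 *
     [exists phi in W, all (fun x : Cantor => x (idx phi)) s]%:R)%:E))%E.
Proof.
elim: n k W => [|n IH] k W gW.
  rewrite big_ord0 subr0 /= lee_fin (_ : [exists _ in _, _] = true)//.
  by have /set0Pn[phi phiW] := good_neq0 gW; apply/existsP; exists phi; rewrite phiW.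
rewrite big_ord_recl addn0; set S := \sum_(l < n) _.
have S0 : 0 <= S by apply: sumr_ge0.
(* If S > 1 the left side is negative; otherwise 1 - S serves as a nonnegative factor. *)
have [S1|S1] := leP S 1; last first.
  apply: le_trans (iid_expect_ge0 _ _ _) => [|s]; last by rewrite lee_fin mulr_ge0 ?invr_ge0.
  by rewrite lee_fin; have := eta_ge0 k; lra.
pose E : set Cantor := [set x : Cantor | good k.+1 [set phi in W | x (idx phi)]%SET].
have mE : measurable E by exact: measurable_survivors.
(* On [E] the induction hypothesis applies to the survivors; off [E] the bound is 0. Moreover (1 -
   S)(1 - eta k) >= 1 - eta k - S. *)
apply: (@le_trans _ _ (\int[mu]_x (2^-1 * (1 - S) * \1_E x)%:E)%E).
  rewrite (_ : \int[mu]_x _ = (2^-1 * (1 - S))%:E * mu E)%E; last first.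
    under eq_integral do rewrite EFinM.
    rewrite integralZl//; last exact: integrable_indic.
    by rewrite integral_indic// setIT.
  apply: (@le_trans _ _ ((2^-1 * (1 - S))%:E * (1 - eta k)%:E)%E).
    rewrite -EFinM lee_fin; have := mulr_ge0 S0 (eta_ge0 k); nra.
  by apply: lee_wpmul2l; [rewrite lee_fin mulr_ge0 ?invr_ge0 ?subr_ge0|exact: good_next].
apply: ge0_le_integral_nomeas => x.
  by rewrite lee_fin !mulr_ge0 ?invr_ge0 ?subr_ge0.
rewrite indicE; case: (boolP (x \in E)) => xE; last first.
  by rewrite mulr0; apply: iid_expect_ge0 => s; rewrite lee_fin mulr_ge0 ?invr_ge0.
rewrite mulr1; move: xE; rewrite inE => gx.
have := IH _ _ gx.
rewrite (eq_bigr (fun l : 'I_n => eta (k + bump 0 l)%N)); last first.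
  by move=> l _; rewrite addSnnS.
move=> /le_trans; apply; apply: le_iid_expect => s; first by rewrite lee_fin mulr_ge0 ?invr_ge0.
move=> _; rewrite lee_fin ler_wpM2l ?invr_ge0// ler_nat; case: existsP => //= -[phi].
rewrite !inE -andbA => h; rewrite (_ : [exists _ in _, _] = true)//.
by apply/existsP; exists phi.
Qed.

Lemma Delta_ge_unanimous n k W : good k W ->
  ((2^-1 * (1 - \sum_(l < n) eta (k + l)%N))%:E <= Delta mu n)%E.
Proof.
move=> gW; apply: le_trans (iid_expect_unanimous n gW) _.
apply: le_iid_expect => s; first by rewrite lee_fin mulr_ge0 ?invr_ge0.
move=> _; case: existsP => [[phi /andP[_ h]]|_]; last by rewrite mulr0 dev_ge0.
by rewrite mulr1; exact: dev_half_of_unanimous h.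
Qed.

End survivors.

(** * Upper bound when late bits agree outside a small event *)

Section tail_event.
Variables (J : nat) (B : set Cantor) (p : R).
Hypotheses (mB : measurable B) (muB : mu B = p%:E).
Hypothesis B_tail : forall x, ~ B x -> forall j, (J <= j)%N -> x j = x J.

(** For the induction, [z] accumulates the centred bits and [C] the visits to [B] of the samples
    already drawn. Cross terms vanish, and a fair bit has variance 1/4. *)
Lemma iid_expect_square_sum n (C a b : R) (z : 'I_J.+1 -> R) :
  iid_expect mu n (fun s =>
    (C + \sum_(j < J.+1) a * (z j + \sum_(x <- s) (bitX j x - 2^-1)) ^+ 2
       + b * \sum_(x <- s) \1_B x)%:E)
  = (C + \sum_(j < J.+1) a * (z j ^+ 2 + n%:R / 4) + b * (n%:R * p))%:E.
Proof.
elim: n C z => [|n IH] C z /=.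
  rewrite [X in b * X]big_nil; congr (_ + _ + _)%:E; last by ring.
  by apply: eq_bigr => j _; rewrite big_nil; ring.
pose v (j : nat) (x : Cantor) : R := bitX j x - 2^-1.
transitivity (\int[mu]_x ((C + b * \1_B x) +
    \sum_(j < J.+1) a * ((z j + v j x) ^+ 2 + n%:R / 4) + b * (n%:R * p))%:E)%E.
  apply: eq_integral => x _; rewrite -IH; congr iid_expect; apply/funext => s.
  congr EFin; rewrite [X in b * X]big_cons.
  rewrite [X in C + X + _](eq_bigr (fun j : 'I_J.+1 =>
    a * (z j + v j x + \sum_(x <- s) (bitX j x - 2^-1)) ^+ 2)); first by ring.
  by move=> j _; rewrite big_cons addrA.
pose f (i : option 'I_J.+1) : Cantor -> R := if i is Some j then v j else \1_B.
pose c (i : option 'I_J.+1) : R := if i is Some j then a * (2 * z j) else b.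
pose e (i : option 'I_J.+1) : R := if i is Some j then 0 else p.
pose A : R := C + \sum_(j < J.+1) a * (z j ^+ 2 + n.+1%:R / 4) + b * (n%:R * p).
(* [None] carries the indicator of [B], [Some j] the linear term in bit [j]; the quadratic term is
   the constant 1/4. *)
pose r : seq (option 'I_J.+1) := None :: map Some (index_enum 'I_J.+1).
transitivity (\int[mu]_x (A + \sum_(i <- r) c i * f i x)%:E)%E.
  apply: eq_integral => x _; congr EFin.
  rewrite /A /r big_cons big_map /= (_ : \sum_(j < J.+1) a * ((z j + v j x) ^+ 2 + n%:R / 4) =
    \sum_(j < J.+1) a * (z j ^+ 2 + n.+1%:R / 4) + \sum_(j < J.+1) a * (2 * z j) * v j x).
    ring.
  rewrite -big_split; apply: eq_bigr => j _ /=.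
  have -> : (z j + v j x) ^+ 2 = z j ^+ 2 + 2 * z j * v j x + 4^-1.
    by rewrite /v /bitX; case: (x j) => /=; field.
  by rewrite -natr1; field.
rewrite (@integral_affine _ _ R mu _ r A c e f).
- rewrite /r big_cons big_map /= big1 ?addr0; last by move=> j _; rewrite mulr0.
  by congr EFin; rewrite /A -natr1; ring.
- case=> [j|]; last exact: integrable_indic.
  apply: (@bounded_integrable _ _ R mu _ 1).
    by apply: measurable_funB => //; exact: measurable_bitX.
  by move=> x; rewrite /f /v /bitX ler_norml; case: (x j) => /=; apply/andP; split; lra.
- case=> [j|] /=; last by rewrite integral_indic// setIT.
  have ib : mu.-integrable [set: Cantor] (EFin \o bitX j).
    apply: (@bounded_integrable _ _ R mu _ 1); first exact: measurable_bitX.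
    by move=> x; rewrite /bitX; case: (x j); rewrite ?normr0 ?normr1.
  have ih : mu.-integrable [set: Cantor] (EFin \o (fun=> 2^-1 : R)).
    by apply: (@bounded_integrable _ _ R mu _ `|2^-1|).
  under eq_integral do rewrite EFinB.
  rewrite integralB_EFin// mu_fair integral_cst// [X in (_ * X)%E](probability_setT mu).
  by rewrite mule1 -EFinB subrr.
Qed.

(** Coordinates up to [J] are bounded by a sum over all of them; a later one differs from coordinate
    [J] only on samples in [B]. Squares replace absolute values so that [iid_expect_square_sum]
    applies, with [0] as the initial [z]. *)
Lemma dev_le_tail s (kappa : R) : 0 < kappa -> (0 < size s)%N ->
  (dev mu s <= (J.+1%:R * kappa
     + \sum_(j < J.+1) (4 * kappa * (size s)%:R ^+ 2)^-1
          * (0 + \sum_(x <- s) (bitX j x - 2^-1)) ^+ 2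
     + (size s)%:R^-1 * \sum_(x <- s) \1_B x)%:E)%E.
Proof.
move=> k0 s0; have sr : 0 < (size s)%:R :> R by rewrite ltr0n.
set n : R := (size s)%:R in sr *.
pose D j : R := \sum_(x <- s) (bitX j x - 2^-1).
pose T (j : nat) : R := kappa + (4 * kappa * n ^+ 2)^-1 * D j ^+ 2.
have T0 j : 0 <= T j.
  by rewrite /T addr_ge0 ?(ltW k0)// mulr_ge0 ?sqr_ge0// invr_ge0 !mulr_ge0 ?sqr_ge0 ?ltW.
(* AM-GM with weight [kappa]. *)
have DT j : `|n^-1 * D j| <= T j.
  have E u : `|u| <= kappa + (4 * kappa)^-1 * u ^+ 2.
    rewrite -(ler_pM2l (_ : 0 < 4 * kappa)) ?mulr_gt0// mulrDr mulVKf ?gt_eqF ?mulr_gt0//.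
    rewrite -[u ^+ 2]real_normK ?num_real//.
    have := sqr_ge0 (`|u| - 2 * kappa); nra.
  apply: le_trans (E _) _; rewrite /T lerD2l exprMn exprVn mulrA -invfM.
  by rewrite lexx.
have devE j : n^-1 * \sum_(x <- s) bitX j x - mean mu j = n^-1 * D j.
  rewrite fair_mean /D sumrB big_const_seq count_predT iter_addr_0 -[_ *+ _]mulr_natl -/n.
  by field; rewrite gt_eqF.
have sumT : J.+1%:R * kappa + \sum_(j < J.+1) (4 * kappa * n ^+ 2)^-1 * (0 + D j) ^+ 2
    = \sum_(j < J.+1) T j.
  rewrite big_split /= sumr_const card_ord mulr_natl; congr (_ + _).
  by apply: eq_bigr => j _; rewrite add0r.
rewrite sumT.
have B0 : 0 <= n^-1 * \sum_(x <- s) \1_B x.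
  by rewrite mulr_ge0 ?invr_ge0 ?(ltW sr)// sumr_ge0.
have TS (j : 'I_J.+1) : T j <= \sum_(j < J.+1) T j.
  by rewrite (bigD1 j)//= lerDl sumr_ge0.
apply: ge_ereal_sup => _ [j _ <-]; rewrite lee_fin devE.
have [jJ|Jj] := ltnP j J.+1.
  by apply: le_trans (DT j) _; apply: le_trans (TS (Ordinal jJ)) _; rewrite lerDl.
apply: (@le_trans _ _ (`|n^-1 * D J| + n^-1 * \sum_(x <- s) \1_B x)); last first.
  by rewrite lerD2r; apply: le_trans (DT J) _; exact: (TS ord_max).
have -> : n^-1 * D j = n^-1 * D J + n^-1 * (D j - D J) by ring.
apply: le_trans (ler_normD _ _) _; rewrite lerD2l normrM ger0_norm ?invr_ge0 ?(ltW sr)//.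
apply: ler_wpM2l; first by rewrite invr_ge0 (ltW sr).
rewrite /D -sumrB; apply: le_trans (ler_norm_sum _ _ _) _; apply: ler_sum => x _.
rewrite indicE; case: (boolP (x \in B)) => xB /=.
  by rewrite /bitX ler_norml; case: (x j); case: (x J) => /=; apply/andP; split; lra.
rewrite /bitX (B_tail _ (ltnW Jj)) ?subrr ?normr0//.
by move/mem_set => xB'; rewrite xB' in xB.
Qed.

Lemma Delta_le_tail n (kappa : R) : 0 < kappa -> (0 < n)%N ->
  (Delta mu n <= (J.+1%:R * (kappa + (16 * kappa * n%:R)^-1) + p)%:E)%E.
Proof.
move=> k0 n0; have nr : 0 < n%:R :> R by rewrite ltr0n.
pose a : R := (4 * kappa * n%:R ^+ 2)^-1.
apply: (@le_trans _ _ (iid_expect mu n (fun s =>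
    (J.+1%:R * kappa
     + \sum_(j < J.+1) a * (0 + \sum_(x <- s) (bitX j x - 2^-1)) ^+ 2
     + n%:R^-1 * \sum_(x <- s) \1_B x)%:E))).
  apply: le_iid_expect => s; first exact: dev_ge0.
  by move=> sn; have := @dev_le_tail s kappa k0; rewrite sn; exact.
rewrite (iid_expect_square_sum n _ a _ (fun=> 0)) lee_fin.
rewrite sumr_const card_ord -[_ *+ _]mulr_natl /a.
rewrite le_eqVlt; apply/orP; left; apply/eqP.
by field; rewrite !gt_eqF.
Qed.

End tail_event.

End fair_law.

(** * The two noises *)

Definition favg (R : realType) (T : finType) (f : T -> R) : R :=
  #|T|%:R^-1 * \sum_x f x.

Lemma avg_nth_enum (R : realType) (T : finType) (x0 : T) (f : T -> R) :
  avg #|T| (fun a => f (nth x0 (enum T) a)) = favg f.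
Proof.
rewrite /avg /favg; congr (_ * _); rewrite [RHS](big_enum_val (A := T)) /=.
by apply: eq_bigr => i _; rewrite (enum_val_nth x0).
Qed.

Lemma favg_prod (R : realType) (S T : finType) (f : S * T -> R) :
  favg f = favg (fun a => favg (fun b => f (a, b))).
Proof.
rewrite /favg card_prod natrM invfM -mulrA; congr (_ * _).
rewrite -mulr_sumr; congr (_ * _).
by rewrite pair_big; apply: eq_bigr => -[].
Qed.

Lemma eq_favg (R : realType) (T : finType) (f g : T -> R) : f =1 g -> favg f = favg g.
Proof. by move=> fg; congr (_ * _); apply: eq_bigr. Qed.

Lemma favg_cst (R : realType) (T : finType) (c : R) : T -> favg (fun _ : T => c) = c.
Proof.
move=> x; rewrite /favg sumr_const -(mulr_natl c) mulKf// pnatr_eq0 -lt0n.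
by apply/card_gt0P; exists x.
Qed.

Section flips.
Variables (R : realType) (s r : nat).

(* The size makes the flip probability 2/#|option cells| under nu half of the
   probability 1/(r + 1) of an event [w.2.1 == None] under mu. *)
Definition cells := 'I_(4 * r).+3.
Definition pattern := {ffun 'I_s.+1 -> cells}.
Definition nu_noise := ('I_s.+1 * option cells)%type.
Definition mu_noise := ('I_s.+1 * (option 'I_r * {ffun cells -> bool}))%type.

Definition nu_flip (phi : pattern) (w : nu_noise) : bool :=
  (w.2 == None) || (w.2 == Some (phi w.1)).

Definition mu_flip (phi : pattern) (w : mu_noise) : bool :=
  (w.2.1 == None) && w.2.2 (phi w.1).

Let sum_eq (T : finType) (x : T) : \sum_(t : T) (t == x)%:R = 1 :> R.
Proof. by rewrite (bigD1 x)//= eqxx big1 ?addr0// => t /negbTE ->. Qed.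

(** [f] is -1 at two of 4 (r + 1) elements and 1 elsewhere: the mean is 1 - 1/(r + 1). *)
Let favg_two (x y : option cells) (f : option cells -> R) : x != y ->
  (forall t, f t = 1 - 2 * (t == x)%:R - 2 * (t == y)%:R) ->
  favg f = r%:R / r.+1%:R.
Proof.
move=> xy fE; rewrite /favg (eq_bigr _ (fun t _ => fE t)) card_option card_ord.
rewrite !sumrB -!mulr_sumr !sum_eq sumr_const card_option card_ord.
have -> : (4 * r).+4%:R = 4 * r.+1%:R :> R by rewrite -natrM; congr (_%:R); lia.
by rewrite -natr1; field.
Qed.

(** On the event of probability 1/(r + 1), [f] is the centred [h]; elsewhere it is 1. The mean
    matches [favg_two]. *)
Let favg_none (h : {ffun cells -> bool} -> R) (f : option 'I_r * {ffun cells -> bool} -> R) :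
  (\sum_e h e = 0) -> (forall w, f w = 1 - (w.1 == None)%:R * (1 - h w.2)) ->
  favg f = r%:R / r.+1%:R.
Proof.
move=> h0 fE; rewrite favg_prod.
pose K : R := #|{ffun cells -> bool}|%:R.
have K0 : K != 0 by rewrite pnatr_eq0 card_ffun card_bool expn_eq0.
have E t : favg (fun e => f (t, e)) = 1 - (t == None)%:R.
  rewrite /favg -/K (eq_bigr _ (fun e _ => fE (t, e))) /= sumrB.
  rewrite -mulr_sumr sumrB h0 subr0 sumr_const cardT -cardE -/K.
  by field.
rewrite (eq_favg E) /favg card_option card_ord sumrB sum_eq sumr_const card_option card_ord.
by rewrite -natr1; field.
Qed.

(** Flipping bit [v] is an involution that negates [h], so the sum is its own opposite. *)
Let sum_odd_coord (v : cells) (h : {ffun cells -> bool} -> R) :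
  (forall e : {ffun cells -> bool}, h [ffun u => (u == v) (+) e u] = - h e) -> \sum_e h e = 0.
Proof.
move=> hN.
pose F (e : {ffun cells -> bool}) := [ffun u => (u == v) (+) e u].
have FK : involutive F.
  by move=> e; apply/ffunP => u; rewrite !ffunE addbA addbb.
have : \sum_e h e = - \sum_e h e.
  rewrite {1}(reindex_inj (inv_inj FK)) -sumrN.
  by apply: eq_bigr => e _; exact: hN.
move=> H; lra.
Qed.

Lemma favg_flip (phi : pattern) :
  favg (fun w => sgb R (nu_flip phi w)) = favg (fun w => sgb R (mu_flip phi w)).
Proof.
rewrite !favg_prod; apply: eq_favg => i.
rewrite (favg_two (x := None) (y := Some (phi i)))//; last first.
  move=> t; rewrite /nu_flip /sgb /=.
  by case: eqP => [->|_] /=; [|case: eqP => _] => /=; rewrite ?expr1 ?expr0; lra.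
rewrite (favg_none (h := fun e => sgb R (e (phi i))))//.
  apply: (@sum_odd_coord (phi i)) => e; rewrite ffunE eqxx /sgb /=.
  by case: (e _); rewrite ?expr1 ?expr0 ?opprK.
case=> t e; rewrite /mu_flip /sgb /=.
by case: eqP => _; case: (e _) => /=; rewrite ?expr1 ?expr0; lra.
Qed.

Lemma favg_flip_mul (phi psi : pattern) :
  favg (fun w => sgb R (nu_flip phi w) * sgb R (nu_flip psi w))
  = favg (fun w => sgb R (mu_flip phi w) * sgb R (mu_flip psi w)).
Proof.
rewrite !favg_prod; apply: eq_favg => i.
have sg2 b : sgb R b * sgb R b = 1 by rewrite /sgb -expr2 sqrr_sign.
have [e|ne] := eqVneq (phi i) (psi i).
  rewrite (eq_favg (g := fun=> 1)); last by move=> t; rewrite /nu_flip /= e sg2.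
  rewrite [RHS](eq_favg (g := fun=> 1)); last by move=> t; rewrite /mu_flip /= e sg2.
  rewrite (favg_cst 1 (None : option cells)).
  by rewrite (favg_cst 1 (None, [ffun=> false] : {ffun cells -> bool})).
(* [None] flips both patterns and cancels in the product; only the cells [phi i] and [psi i] flip
   exactly one. *)
rewrite (favg_two (x := Some (phi i)) (y := Some (psi i)))//; last first.
  move=> t; rewrite /nu_flip /sgb /=; case: t => [t|] /=; last by rewrite !expr1; lra.
  have [->|t1] := eqVneq t (phi i).
    by rewrite !eqxx /= (inj_eq Some_inj) (negbTE ne) /= expr0 expr1; lra.
  rewrite !(inj_eq Some_inj) (negbTE t1) /=.
  by case: eqP => _ /=; rewrite ?expr1 ?expr0; lra.
rewrite (favg_none (h := fun e => sgb R (e (phi i)) * sgb R (e (psi i))))//.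
  apply: (@sum_odd_coord (phi i)) => e; rewrite !ffunE eqxx (eq_sym (psi i)) (negbTE ne) /sgb /=.
  by case: (e (phi i)); rewrite ?expr1 ?expr0 ?mulN1r ?mul1r ?opprK.
case=> t e; rewrite /mu_flip /sgb /=.
by case: eqP => _; case: (e _) => /=; case: (e _) => /=; rewrite ?expr1 ?expr0; lra.
Qed.

Lemma favg_mu_hit : favg (fun w : mu_noise => (w.2.1 == None)%:R : R) = r.+1%:R^-1.
Proof.
rewrite favg_prod (eq_favg (g := fun=> r.+1%:R^-1)) => [|i].
  by rewrite (favg_cst _ (ord0 : 'I_s.+1)).
rewrite favg_prod /= (eq_favg (g := fun t => (t == None)%:R)) => [|t].
  by rewrite /favg sum_eq card_option card_ord mulr1.
by rewrite (favg_cst _ ([ffun=> false] : {ffun cells -> bool})).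
Qed.

Lemma favg_nu_bad (D : {set 'I_s.+1}) :
  favg (fun w : nu_noise => ((w.1 \in D) || (w.2 == None))%:R : R)
  <= #|D|%:R / s.+1%:R + (4 * r).+4%:R^-1.
Proof.
apply: (@le_trans _ _ (favg (fun w : nu_noise => (w.1 \in D)%:R : R)
    + favg (fun w : nu_noise => (w.2 == None)%:R : R))).
  rewrite /favg -mulrDr -big_split ler_wpM2l ?invr_ge0//=.
  by apply: ler_sum => w _; case: (_ \in D); case: (_ == None); rewrite /=; lra.
rewrite !favg_prod /=; apply: lerD.
  rewrite (eq_favg (g := fun i => (i \in D)%:R)) => [|i]; last first.
    by rewrite (favg_cst _ (None : option cells)).
  by rewrite /favg card_ord -natr_sum -big_mkcond sum1_card mulrC.
rewrite (eq_favg (g := fun=> (4 * r).+4%:R^-1)) => [|i].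
  by rewrite (favg_cst _ (ord0 : 'I_s.+1)).
by rewrite /favg sum_eq card_option card_ord mulr1.
Qed.

End flips.

(** * The two laws *)

(** An index [j] that codes no pattern gets the default of block [j], so that these indices too
    leave every finite set of blocks. *)
Lemma enum_blocks (F : nat -> finType) (x0 : forall m, F m) :
  exists e : nat -> {m : nat & F m},
    (forall m (phi : F m), exists j, e j = Tagged F phi) /\
    (forall M, exists J, forall j, (J <= j)%N -> (M <= tag (e j))%N).
Proof.
exists (fun j => odflt (Tagged F (x0 j)) (pickle_inv j)); split => [m phi|M].
  by exists (pickle (Tagged F phi)); rewrite pickleK_inv.
(* From [J] on no index codes a pattern of the first [M] blocks; from [M] on the default is late
   enough. *)
pose J := (\max_(m < M) \max_(phi : F m) (pickle (Tagged F phi)).+1)%N.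
exists (maxn J M) => j; rewrite geq_max => /andP[Jj Mj].
case ej: (pickle_inv j) => [[m phi]|] //=.
rewrite leqNgt; apply/negP => mM; move: Jj; apply/negP; rewrite -ltnNge.
have <- : pickle (Tagged F phi) = j.
  by have := @pickle_invK {m : nat & F m} j; rewrite ej.
apply: leq_trans (leq_bigmax (Ordinal mM)).
exact: (leq_bigmax (F := fun phi : F m => (pickle (Tagged F phi)).+1) phi).
Qed.

(** * Block laws with noise uniform on finite types *)

Section noise_law.
Variables (R : realType) (F : nat -> finType) (e : nat -> {m : nat & F m}).
Variables (N : nat -> finType) (w0 : forall m, N m).
Variable flip : forall m, F m -> N m -> bool.

(** [block_radices] adds the 1 back. *)
Definition noise_radix (m : nat) : nat := #|N m|.-1.
Definition noise_of (m a : nat) : N m := nth (w0 m) (enum (N m)) a.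
Definition noise_bit (j a : nat) : bool :=
  flip (tagged (e j)) (noise_of (tag (e j)) a).

Definition noise_law : probability Cantor R :=
  law R noise_radix (fun j => tag (e j)) noise_bit.

Lemma avg_noise m (f : N m -> R) :
  avg (noise_radix m).+1 (fun a => f (noise_of m a)) = favg f.
Proof.
rewrite /noise_radix prednK ?avg_nth_enum//.
by apply/card_gt0P; exists (w0 m).
Qed.

Lemma noise_corr i j m (phi psi : F m) : e i = Tagged F phi -> e j = Tagged F psi ->
  block_corr R noise_radix (fun j => tag (e j)) noise_bit i j =
  favg (fun w => sgb R (flip phi w) * sgb R (flip psi w)).
Proof.
rewrite /block_corr /noise_bit => -> -> /=; rewrite eqxx.
exact: (avg_noise (fun w => sgb R (flip phi w) * sgb R (flip psi w))).
Qed.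

Lemma noise_corr_neq i j m m' (phi : F m) (psi : F m') :
  e i = Tagged F phi -> e j = Tagged F psi -> m != m' ->
  block_corr R noise_radix (fun j => tag (e j)) noise_bit i j =
  favg (fun w => sgb R (flip phi w)) * favg (fun w => sgb R (flip psi w)).
Proof.
rewrite /block_corr /noise_bit => -> -> /= /negbTE ->.
rewrite (avg_noise (fun w => sgb R (flip phi w))).
by rewrite (avg_noise (fun w => sgb R (flip psi w))).
Qed.

Lemma unif01_noise m (A : pred (N m)) :
  unif01 [set w : R | A (noise_of m (digit (block_radices noise_radix) m.+1 w))]
  = (favg (fun w => (A w)%:R : R))%:E.
Proof.
have H k : (0 < block_radices noise_radix k)%N by case: k.
rewrite (@unif01_digit R _ H m.+1 (fun a => A (noise_of m a))).
by rewrite -(avg_noise (fun w => (A w)%:R)).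
Qed.

Local Notation sample := (bits noise_radix (fun j => tag (e j)) noise_bit).
Local Notation dig := (@digit R (block_radices noise_radix)).

Lemma noise_law_bit j m (phi : F m) (w : R) : e j = Tagged F phi ->
  sample w j = odd (dig 0 w) (+) flip phi (noise_of m (dig m.+1 w)).
Proof. by rewrite /bits /noise_bit => ->. Qed.

(** Noise of block [m] in [A] forces [E] whatever the coin and the other blocks do. *)
Lemma noise_law_ge m (A : pred (N m)) (E : set Cantor) : measurable E ->
  (forall w, A (noise_of m (dig m.+1 w)) -> E (sample w)) ->
  ((favg (fun w => (A w)%:R))%:E <= noise_law E)%E.
Proof.
move=> mE AE; rewrite -unif01_noise; apply: le_measure; rewrite ?inE//.
  apply: (@measurable_digit R (block_radices noise_radix) _ m.+1
    [set a | A (noise_of m a)]); by case.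
by rewrite -[X in measurable X]setTI; exact: measurable_bits.
Qed.

End noise_law.

Lemma noise_law_moments (R : realType) (F : nat -> finType) (e : nat -> {m : nat & F m})
    (N N' : nat -> finType) (w0 : forall m, N m) (w0' : forall m, N' m)
    (flip : forall m, F m -> N m -> bool) (flip' : forall m, F m -> N' m -> bool) i j :
  (forall m (phi : F m),
    favg (fun w => sgb R (flip m phi w)) = favg (fun w => sgb R (flip' m phi w))) ->
  (forall m (phi psi : F m),
    favg (fun w => sgb R (flip m phi w) * sgb R (flip m psi w)) =
    favg (fun w => sgb R (flip' m phi w) * sgb R (flip' m psi w))) ->
  (\int[noise_law R e w0 flip]_x (bitX i x * bitX j x)%:E =
   \int[noise_law R e w0' flip']_x (bitX i x * bitX j x)%:E)%E.
Proof.
move=> h1 h2; rewrite !second_moment; congr ((_ + _) / _)%:E.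
case ei: (e i) => [m phi]; case ej: (e j) => [m' psi].
have [E|ne] := eqVneq m m'; last first.
  by rewrite !(@noise_corr_neq R F e _ _ _ i j m m' phi psi ei ej ne) !h1.
by move: psi ej; rewrite -E => psi ej; rewrite !(@noise_corr R F e _ _ _ i j m phi psi ei ej) h2.
Qed.

Section two_laws.
Variable R : realType.

(** Since r m + 1 = 2^m, the events under [mu] have summable probabilities, and [None] becomes rare
    under [nu]. *)
Let r (m : nat) : nat := (2 ^ m).-1.
Let F (m : nat) : finType := pattern m (r m).
Variable e : nat -> {m : nat & F m}.
Hypothesis e_surj : forall m (phi : F m), exists j, e j = Tagged F phi.
Hypothesis e_tail : forall M, exists J, forall j, (J <= j)%N -> (M <= tag (e j))%N.

Let Nnu (m : nat) : finType := nu_noise m (r m).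
Let Nmu (m : nat) : finType := mu_noise m (r m).
Let wnu m : Nnu m := (ord0, None).
Let wmu m : Nmu m := (ord0, (None, [ffun=> false])).

Let nu := noise_law R e wnu (fun m => @nu_flip m (r m)).
Let mu := noise_law R e wmu (fun m => @mu_flip m (r m)).

Lemma mu_nu_moments i j :
  (\int[mu]_x (bitX i x * bitX j x)%:E = \int[nu]_x (bitX i x * bitX j x)%:E)%E.
Proof.
apply: noise_law_moments => m phi; first by rewrite favg_flip.
by move=> psi; rewrite favg_flip_mul.
Qed.

(** * Unanimous samples under [nu] *)

Section unanimity.
Variable m : nat.

Let idx (phi : F m) : nat := projT1 (cid (e_surj phi)).

Let idxP (phi : F m) : e (idx phi) = Tagged F phi.
Proof. exact: projT2 (cid (e_surj phi)). Qed.

(** The invariant for [Delta_ge_unanimous]: after [k] samples at most [k] columns are committed, and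
    the others remain free. *)
Let has_box (k : nat) (W : {set F m}) : bool :=
  [exists D : {set 'I_m.+1}, exists v : F m, (#|D| <= k)%N &&
    [forall phi : F m, [forall i in D, phi i == v i] ==> (phi \in W)]].

Let has_boxP k (W : {set F m}) : reflect
  (exists (D : {set 'I_m.+1}) (v : F m), (#|D| <= k)%N /\
    forall phi : F m, (forall i, i \in D -> phi i = v i) -> phi \in W) (has_box k W).
Proof.
apply: (iffP existsP) => [[D /existsP[v /andP[Dk /forallP h]]]|[D [v [Dk h]]]].
  exists D, v; split => // phi vD; have /implyP := h phi; apply.
  by apply/forallP => i; apply/implyP => iD; rewrite vD.
exists D; apply/existsP; exists v; rewrite Dk; apply/forallP => phi.
by apply/implyP => /forallP vD; apply: h => i iD; have /implyP/(_ iD)/eqP := vD i.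
Qed.

(** The cost of meeting a committed column or drawing [None]. *)
Let eta (k : nat) : R := k%:R / m.+1%:R + (4 * r m).+4%:R^-1.

Let eta_ge0 k : 0 <= eta k.
Proof. by rewrite /eta addr_ge0// ?divr_ge0// invr_ge0. Qed.

Let has_box_neq0 k (W : {set F m}) : has_box k W -> W != finset.set0.
Proof. by case/has_boxP => D [v [_ h]]; apply/set0Pn; exists v; exact: h. Qed.

Let has_box_next k (W : {set F m}) : has_box k W ->
  ((1 - eta k)%:E <=
     nu [set x | has_box k.+1 [set phi in W | x (idx phi)]%SET])%E.
Proof.
case/has_boxP => D [v [Dk h]].
pose bad (w : Nnu m) := (w.1 \in D) || (w.2 == None).
apply: (@le_trans _ _ (favg (fun w => (~~ bad w)%:R))%:E).
  rewrite lee_fin (_ : favg _ = 1 - favg (fun w => (bad w)%:R)).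
    rewrite lerD2l lerN2; apply: le_trans (favg_nu_bad R (r m) D) _.
    by rewrite lerD2r ler_wpM2r ?invr_ge0// ler_nat.
  rewrite -[X in X - _](favg_cst 1 (wnu m)) /favg -mulrBr -sumrB.
  by congr (_ * _); apply: eq_bigr => w _; case: (bad w); rewrite ?subrr ?subr0.
apply: noise_law_ge; first exact: measurable_survivors.
move=> w; set om := noise_of _ _ _; rewrite /bad negb_or => /andP[iD].
case t: om.2 => [t0|//] _; set c := odd (digit (block_radices (noise_radix Nnu)) 0 w).
pose i0 := om.1.
have [t1 t10] : exists t1 : cells (r m), t1 != t0.
  have [->|?] := eqVneq t0 ord0; last by exists ord0; rewrite eq_sym.
  by exists ord_max.
(* With coin 1 the bit must not be flipped, hence a cell other than [t0]; with coin 0 it must be,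
   hence [t0]. *)
apply/has_boxP; exists (i0 |: D), [ffun i => if i == i0 then (if c then t1 else t0) else v i].
split; first by rewrite cardsU1 iD add1n ltnS.
move=> phi vD; rewrite inE; apply/andP; split.
  apply: h => i Di; rewrite vD ?inE ?Di ?orbT// ffunE ifN//.
  by apply: contraNneq iD => ii0; rewrite -/i0 -ii0.
have phi0 : phi i0 = if c then t1 else t0 by rewrite vD ?setU11// ffunE eqxx.
rewrite (noise_law_bit _ _ _ (idxP phi)) -/om -/c /nu_flip t /= -/i0 phi0.
by case: c {phi0 vD} => /=; rewrite (inj_eq Some_inj) ?eqxx// eq_sym (negbTE t10).
Qed.

Lemma Delta_nu_ge n : ((2^-1 - n%:R ^+ 2 / m.+1%:R)%:E <= Delta nu n)%E.
Proof.
have nu_fair := law_fair R (noise_radix Nnu) (fun j => tag (e j))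
  (noise_bit e wnu (fun m => @nu_flip m (r m))).
have box0 : has_box 0 [set: F m]%SET.
  by apply/has_boxP; exists finset.set0, [ffun=> ord0]; rewrite cards0; split.
apply: le_trans (Delta_ge_unanimous nu_fair eta_ge0 has_box_neq0 has_box_next n box0).
rewrite lee_fin.
(* As 4 * 2^m >= m + 1, the [None] term is at most 1/(m + 1), and k + 1 <= n. *)
have etaB k : (k < n)%N -> eta k <= n%:R / m.+1%:R.
  move=> kn; rewrite /eta; apply: (@le_trans _ _ (k%:R / m.+1%:R + m.+1%:R^-1)).
    rewrite lerD2l lef_pV2 ?posrE ?ltr0n// ler_nat /r.
    have := ltn_expl m (isT : (1 < 2)%N); lia.
  by rewrite -[X in _ + X]mul1r -mulrDl natr1 ler_wpM2r ?invr_ge0// ler_nat.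
have S : \sum_(l < n) eta (0 + l)%N <= n%:R ^+ 2 / m.+1%:R.
  apply: (@le_trans _ _ (\sum_(l < n) n%:R / m.+1%:R)).
    by apply: ler_sum => l _; exact: (etaB _ (ltn_ord l)).
  by rewrite sumr_const card_ord -(mulr_natl (n%:R / m.+1%:R)) mulrA -expr2.
have S0 : 0 <= \sum_(l < n) eta (0 + l)%N by exact: sumr_ge0.
rewrite mulrBr mulr1 lerD2l lerN2; apply: le_trans S.
by apply: ler_piMl S0 _; lra.
Qed.

End unanimity.

(** The block [m] is arbitrary in [Delta_nu_ge], so its error n^2/(m + 1) can be made as small as
    desired for fixed [n]. *)
Lemma Delta_nu n : Delta nu n = (2^-1)%:E.
Proof.
have nu_fair := law_fair R (noise_radix Nnu) (fun j => tag (e j))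
  (noise_bit e wnu (fun m => @nu_flip m (r m))).
apply/eqP; rewrite eq_le Delta_le_half//=; apply/lee_addgt0Pr => eps eps0.
pose m := Num.truncn (n%:R ^+ 2 / eps).
apply: (@le_trans _ _ ((2^-1 - n%:R ^+ 2 / m.+1%:R)%:E + eps%:E)%E); last first.
  by rewrite leeD2r// Delta_nu_ge.
rewrite -EFinD lee_fin; suff : n%:R ^+ 2 / m.+1%:R <= eps.
  by move: (n%:R ^+ 2 / _) => z; lra.
by rewrite ler_pdivrMr// mulrC -ler_pdivrMr// ltW// truncnS_gt.
Qed.

(** * Agreement of late bits under [mu] *)

Section tail.
Variables M J : nat.
Hypothesis e_J : forall j, (J <= j)%N -> (M <= tag (e j))%N.

Definition disagreement : set Cantor :=
  \bigcup_(j in [set j | (J <= j)%N]) [set x : Cantor | x j != x J].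

Lemma measurable_disagreement : measurable disagreement.
Proof.
apply: bigcup_measurable => j _.
rewrite (_ : [set _ | _] = ([set x : Cantor | x j] `\` [set x | x J]) `|`
    ([set x : Cantor | x J] `\` [set x | x j])).
  by apply: measurableU; apply: measurableD; exact: measurable_bit.
apply/seteqP; split => x /=.
  by case: (x j); case: (x J) => //= _; [left|right].
by case: (x j); case: (x J) => //= -[[]//|[]//].
Qed.

(** If no block from [M] on is hit, all bits from [J] on equal the coin. The union bound sums 2^-m
    over m >= M. *)
Lemma mu_disagreement : (mu disagreement <= (2 / (2 ^ M)%:R)%:E)%E.
Proof.
pose q := block_radices (noise_radix Nmu).
pose hit m : set R := [set w : R | (noise_of wmu m (digit q m.+1 w)).2.1 == None].
have mhit m : measurable (hit m : set (measurableTypeR R)).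
  apply: (@measurable_digit R q _ m.+1 [set a | (noise_of wmu m a).2.1 == None]).
  by case.
have hitE m : unif01 (hit m) = ((2 ^ m)%:R^-1)%:E.
  rewrite /hit (unif01_noise R wmu (fun w : Nmu m => w.2.1 == None)).
  by rewrite favg_mu_hit /r prednK// expn_gt0.
have mB : measurable (bits (noise_radix Nmu) (fun j => tag (e j))
    (noise_bit e wmu (fun m => @mu_flip m (r m))) @^-1` disagreement :
    set (measurableTypeR R)).
  rewrite -[X in measurable X]setTI; apply: measurable_bits => //.
  exact: measurable_disagreement.
apply: (@le_trans _ _ (\sum_(n <oo) unif01 (hit (M + n)%N))%E).
  apply: (measure_sigma_subadditive _ (fun n => mhit (M + n)%N) mB).
  move=> w [j /= Jj /eqP].
  have bE j' : (J <= j')%N ->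
      ~ (\bigcup_n hit (M + n)%N) w ->
      bits (noise_radix Nmu) (fun j => tag (e j))
        (noise_bit e wmu (fun m => @mu_flip m (r m))) w j' = odd (digit q 0 w).
    move=> Jj' nh; have := e_J Jj'; case ej: (e j') => [m phi] /= Mm.
    rewrite (noise_law_bit _ _ _ ej) /mu_flip.
    case: eqP => [h|_]; last by rewrite addbF.
    by exfalso; apply: nh; exists (m - M)%N => //; rewrite /hit subnKC//=; apply/eqP.
  by move=> ne; apply: contrapT => nh; apply: ne; rewrite !bE.
(* The form c / 2^(n + 1) with c = 2 / 2^M is the one that [epsilon_trick0] sums to at most c. *)
rewrite (eq_eseriesr (g := fun n => ((2 / (2 ^ M)%:R) / (2 ^ n.+1)%:R)%:E)%E); last first.
  move=> n _; rewrite hitE expnD expnS !natrM; congr EFin; field.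
  by rewrite !pnatr_eq0 !expn_eq0.
by apply: epsilon_trick0; rewrite divr_ge0.
Qed.

End tail.

Lemma Delta_mu_cvg0 : Delta mu n @[n --> \oo] --> 0%E.
Proof.
have mu_fair := law_fair R (noise_radix Nmu) (fun j => tag (e j))
  (noise_bit e wmu (fun m => @mu_flip m (r m))).
have D0 n : (0 <= Delta mu n)%E by apply: iid_expect_ge0 => s; exact: dev_ge0.
have Dfin n : Delta mu n \is a fin_num.
  by rewrite ge0_fin_numE// (le_lt_trans (Delta_le_half mu_fair n))// ltry.
apply/fine_cvgP; split; first exact: nearW.
apply/cvgrPdist_le => eps eps0.
(* As 2^M >= M > 4 / eps, the tail event costs at most eps / 2. *)
pose M := (Num.truncn (4 / eps)).+1.
have [J e_J] := e_tail M.
pose B := disagreement J.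
have mB : measurable B := measurable_disagreement J.
pose p := fine (mu B).
have muB : mu B = p%:E by rewrite fineK// fin_num_measure.
have pe : p <= eps / 2.
  rewrite -lee_fin -muB; apply: le_trans (mu_disagreement e_J) _; rewrite lee_fin.
  have P0 : 0 < (2 ^ M)%:R :> R by rewrite ltr0n expn_gt0.
  have MP : M%:R <= (2 ^ M)%:R :> R by rewrite ler_nat ltnW// ltn_expl.
  have := truncnS_gt (4 / eps); rewrite -/M ltr_pdivrMr// => h.
  by rewrite ler_pdivrMr//; nra.
have B_tail x : ~ B x -> forall j, (J <= j)%N -> x j = x J.
  by move=> nB j Jj; apply/eqP/negPn/negP => ne; apply: nB; exists j.
(* [kappa] makes the first term of [Delta_le_tail] equal to eps / 4, and [N0] then brings the term
   in 1/n below eps / 4. *)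
pose kappa : R := eps / (4 * J.+1%:R).
have J0 : 0 < J.+1%:R :> R by rewrite ltr0n.
have k0 : 0 < kappa by rewrite divr_gt0// mulr_gt0.
pose N0 := (Num.truncn (J.+1%:R / (4 * kappa * eps))).+1.
exists N0 => // n /= N0n.
have n0 : (0 < n)%N by exact: leq_trans N0n.
have nr : 0 < n%:R :> R by rewrite ltr0n.
rewrite sub0r normrN ger0_norm ?fine_ge0// -lee_fin fineK//.
apply: le_trans (Delta_le_tail mu_fair mB muB B_tail k0 n0) _; rewrite lee_fin.
have h1 : J.+1%:R * kappa = eps / 4 by rewrite /kappa; field; rewrite gt_eqF.
have h2 : J.+1%:R * (16 * kappa * n%:R)^-1 <= eps / 4.
  have := truncnS_gt (J.+1%:R / (4 * kappa * eps)); rewrite -/N0.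
  have N0n' : N0%:R <= n%:R :> R by rewrite ler_nat.
  move=> /lt_le_trans /(_ N0n'); rewrite ltr_pdivrMr ?mulr_gt0// => h.
  rewrite ler_pdivrMr ?mulr_gt0//; nra.
rewrite mulrDr h1; lra.
Qed.

End two_laws.

Theorem theorem3 (R : realType) :
  exists mu nu : probability Cantor R,
    (forall i j : nat,
        (\int[mu]_x (bitX i x * bitX j x)%:E
         = \int[nu]_x (bitX i x * bitX j x)%:E)%E) /\
    (Delta mu n @[n --> \oo] --> 0%E) /\
    (Delta nu n @[n --> \oo] --> (2^-1)%:E).
Proof.
pose F m : finType := pattern m (2 ^ m).-1.
have [e [e_surj e_tail]] := @enum_blocks F (fun m => [ffun=> ord0]).
do 2!eexists; split; first exact: (mu_nu_moments R e).
split; first exact: Delta_mu_cvg0.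
rewrite (_ : (fun n => _) = fun=> (2^-1)%:E); first exact: cvg_cst.
by apply/funext => n; exact: Delta_nu.
Qed.
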